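(* Let $F$, $\theta$, $\psi=1-\theta$, $(r_k)$, $(y_k)$, $(z_k)$, $\gamma,\sigma\ge1$ satisfy the standing assumption (A) of the context. Let $\tau\in(0,1]$ be such that $\psi(y_k^i/r_k)+\psi(z_k^i/r_k)\ge\tau$ for all $1\le i\le d$ and $k\in\mathbb{N}$ (such a $\tau$ exists). Then the following hold for each $i\in\{1,\dots,d\}$ and $k\in\mathbb{N}$, with constants $C$ independent of $i$ and $k$. (i) (Complementarity errors) There exists $C\ge0$ such that $$\min\{y_k^i,z_k^i\}\le\frac{2-\tau}{\tau}r_k,\qquad 0\le y_k^iz_k^i\le\frac{2-\tau}{\tau}r_k^2+\frac{C|\psi'(0)|}{\tau}(y_k^i+z_k^i)\,r_k^{\sigma}.$$ (ii) (Error for the equation $F(x)=|x|$) Set $x_k:=y_k-z_k$. There exists $C\ge0$ such that $$\big|F(x_k)^i-|x_k^i|\big|\le\Big(C+\frac{4-2\tau}{\tau}\Big)r_k.$$ Suppose, in addition, that $F:\mathbb{R}^d\to\mathbb{R}^d$ is continuous and $F-I$ is a uniform $P$-map with a modulus $h$ satisfying $h(t)\ge t^\beta$ for some $\beta>1$, and let $H(y)=y-(F+I)^{-1}(2y)$, $y\in\mathbb{R}^d$. Then, for each $i\in\{1,\dots,d\}$ and $k\in\mathbb{N}$: (iii) (Approximation of $H$) $\|z_k-H(y_k)\|\le O\big(r_k^{\frac{\gamma}{\beta-1}}\big)$. (iv) The sequences $\{y_k\}$ and $\{z_k\}$ are bounded. (v) (Complementarity errors) If $\gamma>\beta-1$,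 then $$\min\{y_k^i,H(y_k)^i\}\le O(r_k)\quad\text{and}\quad y_k^iH(y_k)^i\le O(r_k^{\tilde\sigma}),\qquad \tilde\sigma:=\min\Big\{2,\sigma,\frac{\gamma}{\beta-1}\Big\}.$$ (vi) (Error for the equation $F(x)=|x|$) If $\gamma>\beta-1$, then $\big|F(y_k-H(y_k))^i-|(y_k-H(y_k))^i|\big|\le O(r_k)$.
   Context: Notation: $|x|$ is coordinatewise; $I$ is the identity; $\|\cdot\|$ is the Euclidean norm; superscripts $i$ denote coordinates. $O(\cdot)$ is with constants independent of $k$ and $i$. A map $G:\mathbb{R}^d\to\mathbb{R}^d$ is a $P_0$-map if for all $x\ne y$, $\max_{i:\,x^i\ne y^i}(x^i-y^i)(G(x)^i-G(y)^i)\ge0$. Given $h:\mathbb{R}_+\to\mathbb{R}_+$ with $h(0)=0<h(t)$ for $t>0$, $G$ is a uniform $P$-map with modulus $h$ if $\max_{1\le i\le d}(x^i-y^i)(G(x)^i-G(y)^i)\ge h(\|x-y\|)$ for all $x,y$. A smoothing function is a smooth (continuously differentiable), concave, increasing function $\theta:\mathbb{R}\to(-\infty,1)$ with $\theta(t)<0$ for $t<0$, $\theta(0)=0$, $\lim_{t\to+\infty}\theta(t)=1$. The function $\theta_1$ is $\theta_1(t)=\frac{t}{t+1}$ for $t\ge0$, $\theta_1(t)=t$ for $t\le 0$, and $\psi_1=1-\theta_1$. For $r>0$ and $y,z\in\mathbb{R}^d$, $G_r(y,z)\in\mathbb{R}^d$ has coordinates $G_r(y,z)^i=r\,\psi^{-1}\big(\psi(y^i/r)+\psi(z^i/r)\big)$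 with $\psi=1-\theta$. Assumption (A): (a) $F:\mathbb{R}^d\to\mathbb{R}^d$ is such that the equation $F(x)=|x|$ has at least one solution and $F$ is $C^1$ in a neighborhood of the solution; $F-I$ is a $P_0$-map. (b) $\theta$ is a smoothing function such that $\psi=1-\theta$ satisfies $\psi\le\psi_1$ and: there exist $a\in(0,1)$ and $R_a>0$ with $\frac{\psi(t)}{2}\ge\psi(\frac{t}{a})$ for all $t\in(R_a,+\infty)$. (c) $(r_k)_{k\in\mathbb{N}}$ is a sequence of positive reals converging to $0$, and $(y_k)_{k\in\mathbb N},(z_k)_{k\in\mathbb N}$ are sequences of vectors in $\mathbb{R}^d$ with nonnegative coordinates such that $\|z_k-F(y_k-z_k)+y_k\|\le\varepsilon_k^{(1)}$ and $G_{r_k}(y_k,z_k)\le\varepsilon_k^{(2)}$ (componentwise), where $\varepsilon_k^{(1)}=O(r_k^\gamma)$, $\varepsilon_k^{(2)}=O(r_k^\sigma)$ with $\gamma,\sigma\ge1$. Under the additional hypotheses on $F$ in the claim, $F+I:\mathbb{R}^d\to\mathbb{R}^d$ is a homeomorphism, so $H$ is well defined; it satisfies $H(y)=F(y-H(y))-y$ for all $y$. *)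

(* Defs.v *)
From HB Require Import structures.
From mathcomp Require Import all_boot all_order all_algebra.
From mathcomp Require Import all_classical all_reals all_analysis.

Set Implicit Arguments.
Unset Strict Implicit.
Unset Printing Implicit Defensive.

Import Order.TTheory GRing.Theory Num.Theory.
Import numFieldNormedType.Exports.

Local Open Scope classical_set_scope.
Local Open Scope ring_scope.

Section Defs.
Context {R : realType}.

(* The library norm `|x| on 'rV[R]_d is the sup norm. *)
Definition enorm (d : nat) (x : 'rV[R]_d) : R :=
  Num.sqrt (\sum_(i < d) x 0 i ^+ 2).

Definition absv (d : nat) (x : 'rV[R]_d) : 'rV[R]_d := \row_i `|x 0 i|.

(* Maxima of reals are taken in \bar R, so that the maximum over an empty index
   set is -oo. *)
Definition P0_map (d : nat) (G : 'rV[R]_d -> 'rV[R]_d) : Prop :=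
  forall x y : 'rV[R]_d, x != y ->
    (0%:E <= \big[Order.max/-oo%E]_(i < d | (x 0 i != y 0 i)%R)
               ((x 0 i - y 0 i) * (G x 0 i - G y 0 i))%R%:E)%E.

(* A modulus is a function on nonnegative reals; its values at negative
   arguments are irrelevant. *)
Definition modulus (h : R -> R) : Prop :=
  h 0 = 0 /\ forall t, 0 < t -> 0 < h t.

Definition uniform_P_map (d : nat) (h : R -> R) (G : 'rV[R]_d -> 'rV[R]_d) :
    Prop :=
  modulus h /\
  forall x y : 'rV[R]_d,
    ((h (enorm (x - y)%R))%:E <= \big[Order.max/-oo%E]_(i < d)
               ((x 0 i - y 0 i) * (G x 0 i - G y 0 i))%R%:E)%E.

Definition C1_near (d : nat) (F : 'rV[R]_d -> 'rV[R]_d) (x : 'rV[R]_d) : Prop :=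
  \forall u \near x, differentiable F u /\ {for u, continuous (jacobian F)}.

Definition smoothing_function (theta : R -> R) : Prop :=
  [/\ (forall t, derivable theta t 1) /\ continuous (derive1 theta),
      convex_function [set: R] (fun t => - theta t),
      {homo theta : s t / s < t},
      forall t, theta t < 1 &
      [/\ forall t, t < 0 -> theta t < 0,
          theta 0 = 0 &
          theta t @[t --> +oo] --> (1 : R)]].

Definition psi (theta : R -> R) (t : R) : R := 1 - theta t.

Definition theta1 (t : R) : R := if 0 <= t then t / (t + 1) else t.

Definition psi1 (t : R) : R := psi theta1 t.

(* pinv setT f is the inverse of f whenever f is a bijection. *)
Definition G_ (theta : R -> R) (d : nat) (r : R) (y z : 'rV[R]_d) : 'rV[R]_d :=
  \row_i (r * pinv setT (psi theta)
                (psi theta (y 0 i / r) + psi theta (z 0 i / r))).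

Definition H_ (d : nat) (F : 'rV[R]_d -> 'rV[R]_d) (y : 'rV[R]_d) : 'rV[R]_d :=
  y - pinv setT (fun x => F x + x) (2 *: y).

Definition assumption_a (d : nat) (F : 'rV[R]_d -> 'rV[R]_d) : Prop :=
  (exists x, F x = absv x /\ C1_near F x) /\ P0_map (fun x => F x - x).

Definition assumption_b (theta : R -> R) : Prop :=
  [/\ smoothing_function theta,
      forall t, psi theta t <= psi1 t &
      exists a Ra, [/\ 0 < a < 1, 0 < Ra &
        forall t, Ra < t -> psi theta (t / a) <= psi theta t / 2]].

Definition assumption_c (d : nat) (F : 'rV[R]_d -> 'rV[R]_d) (theta : R -> R)
    (r : nat -> R) (y z : nat -> 'rV[R]_d) (eps1 eps2 : nat -> R)
    (gamma sigma : R) : Prop :=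
  [/\ (forall k, 0 < r k) /\ r k @[k --> \oo] --> (0 : R),
      forall k i, 0 <= y k 0 i /\ 0 <= z k 0 i,
      (forall k, enorm (z k - F (y k - z k) + y k) <= eps1 k) /\
      (forall k i, G_ theta (r k) (y k) (z k) 0 i <= eps2 k),
      (exists C, forall k, `|eps1 k| <= C * r k `^ gamma) /\
      (exists C, forall k, `|eps2 k| <= C * r k `^ sigma) &
      1 <= gamma /\ 1 <= sigma].

Definition tau_bound (theta : R -> R) (d : nat) (r : nat -> R)
    (y z : nat -> 'rV[R]_d) (tau : R) : Prop :=
  0 < tau <= 1 /\
  forall (i : 'I_d) k,
    tau <= psi theta (y k 0 i / r k) + psi theta (z k 0 i / r k).

End Defs.

(* Main.v *)
(* The bound psi <= psi_1 turns the smoothed constraint into an inequality on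
   1/(1 + y/r) + 1/(1 + z/r), from which (i) and (ii) are elementary algebra.
   A uniform P-map with modulus at least t^beta obeys the error bound
   |x - x'|^(beta - 1) <= |G x - G x'|; applied to F + I at y_k - z_k and
   y_k - H(y_k) it gives (iii), and applied to F - I at y_k - z_k and a solution
   of F(x) = |x| it gives (iv), since |t| - t is nonincreasing.  Estimates (v) and
   (vi) follow by perturbation.  That H is well defined requires F + I to be onto,
   which is shown one coordinate at a time by the intermediate value theorem. *)

Require Import Defs.
From HB Require Import structures.
From mathcomp Require Import all_boot all_order all_algebra.
From mathcomp Require Import all_classical all_reals all_analysis.
From mathcomp Require Import ring lra.

Set Implicit Arguments.
Unset Strict Implicit.
Unset Printing Implicit Defensive.

Import Order.TTheory GRing.Theory Num.Theory.
Import numFieldNormedType.Exports.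

Local Open Scope classical_set_scope.
Local Open Scope ring_scope.

(** * The Euclidean norm against coordinates and the sup norm *)

Section EuclideanNorm.
Context {R : realType} {d : nat}.
Implicit Types x y : 'rV[R]_d.

Lemma enorm_ge0 x : 0 <= enorm x.
Proof. exact: sqrtr_ge0. Qed.

Lemma coord_le_enorm x i : `|x 0 i| <= enorm x.
Proof.
rewrite -sqrtr_sqr ler_sqrt; last by apply: sumr_ge0 => j _; exact: sqr_ge0.
by rewrite (bigD1 i) //= lerDl sumr_ge0 // => j _; exact: sqr_ge0.
Qed.

Lemma enorm_le_coord x c : 0 <= c -> (forall i, `|x 0 i| <= c) ->
  enorm x <= Num.sqrt d%:R * c.
Proof.
move=> c0 xc; rewrite -[X in _ * X]ger0_norm// -sqrtr_sqr -sqrtrM ?ler0n//.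
rewrite ler_sqrt ?mulr_ge0 ?sqr_ge0//.
apply: (@le_trans _ _ (\sum_(i < d) c ^+ 2)).
  by apply: ler_sum => i _; rewrite -real_normK ?num_real// lerXn2r ?nnegrE.
by rewrite sumr_const card_ord mulr_natl.
Qed.

Lemma coord_le_mxnorm x i : `|x 0 i| <= `|x|.
Proof. by rewrite [leRHS]mx_normrE (le_bigmax _ _ (0, i)). Qed.

Lemma mxnorm_le_enorm x : `|x| <= enorm x.
Proof.
rewrite [leLHS]mx_normrE; apply: bigmax_le => [|[i j] _ /=]; first exact: enorm_ge0.
by rewrite ord1 coord_le_enorm.
Qed.

End EuclideanNorm.

(** * P-maps with power modulus and their error bound *)

Section PowerP.
Context {R : realType} {d : nat}.
Implicit Types (x y : 'rV[R]_d) (G : 'rV[R]_d -> 'rV[R]_d) (b e : R).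

(** A witnessing index replaces the maximum, so that no extended reals occur below. *)
Definition power_P_map b G := forall x y, exists i : 'I_d,
  enorm (x - y) `^ b <= (x 0 i - y 0 i) * (G x 0 i - G y 0 i).

Lemma uniform_P_power_P (h : R -> R) b G : (0 < d)%N ->
  uniform_P_map h G -> (forall t, 0 <= t -> t `^ b <= h t) ->
  power_P_map b G.
Proof.
move=> d0 [_ hG] hb x y; apply: contrapT => /forallNP H.
have := hG x y; rewrite leNgt => /negP; apply; apply: bigmax_lt.
  by rewrite ltNyr.
move=> i _; rewrite lte_fin; apply: lt_le_trans (hb _ (enorm_ge0 _)).
by have /negP := H i; rewrite -ltNge.
Qed.

(** Passing from [G - I] to [G + I] adds a nonnegative square to the product at every index. *)
Lemma power_P_map_addx b G :
  power_P_map b (fun x => G x - x) -> power_P_map b (fun x => G x + x).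
Proof.
move=> hG x y; have [i hi] := hG x y; exists i; apply: le_trans hi _.
rewrite !mxE -subr_ge0.
rewrite [X in 0 <= X](_ : _ = 2 * (x 0 i - y 0 i) ^+ 2); last by ring.
by rewrite mulr_ge0// sqr_ge0.
Qed.

(** At the index given by the P-property, [n ^ b <= n * e] with [n = enorm (x - y)]; divide by [n]
    and take roots. Bounding products instead of [G x - G y] leaves room for terms of favourable
    sign and for coordinates where [x] and [y] agree. *)
Lemma power_P_map_error b G x y e : 1 < b -> power_P_map b G -> 0 <= e ->
  (forall i, (x 0 i - y 0 i) * (G x 0 i - G y 0 i) <= `|x 0 i - y 0 i| * e) ->
  enorm (x - y) <= e `^ (b - 1)^-1.
Proof.
move=> b1 hG e0 he; have b1' : 0 < b - 1 by rewrite subr_gt0.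
have [n0|n0] := eqVneq (enorm (x - y)) 0; first by rewrite n0 powR_ge0.
have n_gt0 : 0 < enorm (x - y) by rewrite lt_neqAle eq_sym n0 enorm_ge0.
have ne : enorm (x - y) `^ (b - 1) <= e.
  rewrite -(ler_pM2l n_gt0); have [i hi] := hG x y.
  have -> : enorm (x - y) * enorm (x - y) `^ (b - 1) = enorm (x - y) `^ b.
    rewrite -{1}(powRr1 (enorm_ge0 _)) -powRD; first by congr (_ `^ _); ring.
    by rewrite n0 implybT.
  apply: (le_trans hi); apply: (le_trans (he i)); apply: ler_wpM2r => //.
  by apply: le_trans (coord_le_enorm _ i); rewrite !mxE.
have -> : enorm (x - y) = (enorm (x - y) `^ (b - 1)) `^ (b - 1)^-1.
  by rewrite -powRrM divff ?gt_eqF// powRr1// enorm_ge0.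
apply: ge0_ler_powR => //; last exact: powR_ge0.
by rewrite invr_ge0 ltW.
Qed.

End PowerP.

(** * Surjectivity of continuous P-maps with power modulus *)

Lemma power_monotone_onto {R : realType} (g : R -> R) b : 1 < b ->
  continuous g -> (forall s t, `|s - t| `^ b <= (s - t) * (g s - g t)) ->
  forall v, exists t, g t = v.
Proof.
move=> b1 cg gm v; have b1' : 0 < b - 1 by rewrite subr_gt0.
have step s t : t < s -> (s - t) `^ (b - 1) <= g s - g t.
  move=> ts; have st0 : 0 < s - t by rewrite subr_gt0.
  rewrite -(ler_pM2l st0) -{1}(powRr1 (ltW st0)) -powRD; last first.
    by rewrite (gt_eqF st0) implybT.
  by rewrite (addrC 1) subrK; have := gm s t; rewrite (gtr0_norm st0).
have [v0|v0] := eqVneq (g 0) v; first by exists 0.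
(* By [step], [g] moves by at least [T ^ (b - 1) = |v - g 0|] on either side of 0, so [v] lies
   between [g (- T)] and [g T]. *)
pose T := `|v - g 0| `^ (b - 1)^-1.
have T0 : 0 < T by rewrite powR_gt0// normr_gt0 subr_eq0 eq_sym.
have TE : T `^ (b - 1) = `|v - g 0|.
  by rewrite -powRrM mulVf ?gt_eqF// powRr1.
have := step T 0 T0; rewrite subr0 TE => gT.
have := step 0 (- T); rewrite oppr_lt0 opprK add0r TE => /(_ T0) gNT.
have [h1 h2] := (ler_norm (v - g 0), ler_norm (- (v - g 0))).
rewrite normrN in h2.
have [|||c _ <-] := @IVT _ g (- T) T v; last by exists c.
- by rewrite ge0_cp// ltW.
- exact: continuous_subspaceT.
- by rewrite ge_min le_max; apply/andP; split; apply/orP; [left|right]; lra.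
Qed.

(* Surjectivity without degree theory: solve for the first m coordinates with
   the others frozen at a.  As a function of the m-th
   coordinate the residual of the next equation is strictly monotone with
   superlinear gap, so that one more coordinate comes from the intermediate
   value theorem. *)
Lemma power_P_partial_onto {R : realType} (d : nat)
    (G : 'rV[R]_d -> 'rV[R]_d) b : 1 < b -> continuous G -> power_P_map b G ->
  forall m, (m <= d)%N -> forall a q : 'rV[R]_d, exists x : 'rV[R]_d,
    (forall j : 'I_d, (m <= j)%N -> x 0 j = a 0 j) /\
    (forall j : 'I_d, (j < m)%N -> G x 0 j = q 0 j).
Proof.
move=> b1 cG hG; elim=> [_ a q|m IH md a q]; first by exists a.
(* [A t] is [a] with its m-th coordinate set to [t]; [X t] below solves the first m equations with
   the other coordinates frozen at [A t]. *)
pose jm := Ordinal md; pose A t := a + (t - a 0 jm) *: delta_mx 0 jm.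
have [X hX] := boolp.choice (fun t => IH (ltnW md) (A t) q).
have Xm t : X t 0 jm = t.
  by rewrite (hX t).1// !mxE !eqxx mulr1 addrC subrK.
have Xa t (j : 'I_d) : (m < j)%N -> X t 0 j = a 0 j.
  move=> mj; rewrite (hX t).1 1?ltnW// !mxE eqxx/= -val_eqE/= gtn_eqF//.
  by rewrite mulr0 addr0.
have Xlast s t (j : 'I_d) : (m <= j)%N -> X s 0 j != X t 0 j -> j = jm.
  rewrite leq_eqVlt => /orP[/eqP mj _|mj]; first exact/val_inj.
  by rewrite !Xa// eqxx.
have cX : continuous X.
  (* [X s] and [Y s] can differ only in the first m coordinates, where [G (X s)] and [G (X t)]
     agree. The error bound thus controls [X s - Y s] by [G (X t) - G (Y s)], which tends to 0
     because [Y s] tends to [X t]. *)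
  move=> t; pose Y s := X t + (s - t) *: delta_mx 0 jm.
  have XY s : enorm (X s - Y s) <= `|G (X t) - G (Y s)| `^ (b - 1)^-1.
    apply: (power_P_map_error b1 hG) => // i; have [im|mi] := ltnP i m.
      rewrite (hX s).2// -((hX t).2 i im); apply: le_trans (ler_norm _) _.
      rewrite normrM ler_wpM2l//.
      by apply: le_trans (coord_le_mxnorm (G (X t) - G (Y s)) i); rewrite !mxE.
    have -> : X s 0 i = Y s 0 i; last by rewrite !subrr normr0 !mul0r.
    rewrite !mxE eqxx/=; move: mi; rewrite leq_eqVlt => /orP[/eqP mi|mi].
      have -> : i = jm by exact/val_inj.
      by rewrite eqxx mulr1 !Xm; ring.
    by rewrite -val_eqE/= gtn_eqF// mulr0 addr0 !Xa.
  have cY : Y s @[s --> t] --> X t.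
    rewrite -[X in _ --> X]addr0 -(scale0r (delta_mx 0 jm)) -(subrr t).
    apply: cvgD; first exact: cvg_cst.
    by apply: cvgZl; apply: cvgB; [exact: cvg_id|exact: cvg_cst].
  have cGY : G (Y s) @[s --> t] --> G (X t).
    by apply: cvg_comp cY _; exact: cG.
  have X0 : X s - Y s @[s --> t] --> (0 : 'rV[R]_d).
    apply/cvgr0Pnorm_lt => e e0.
    have /cvgrPdist_lt/(_ _ (powR_gt0 (b - 1) e0)) := cGY; apply: filterS => s hs.
    apply: le_lt_trans (mxnorm_le_enorm _) _; apply: le_lt_trans (XY s) _.
    have -> : e = (e `^ (b - 1)) `^ (b - 1)^-1.
      by rewrite -powRrM divff ?powRr1 ?ltW// gt_eqF// subr_gt0.
    by rewrite gt0_ltr_powR ?nnegrE ?powR_ge0 ?invr_gt0 ?subr_gt0.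
  have XE : X = (fun s => X s - Y s + Y s) by apply/funext => s; rewrite [RHS]subrK.
  by rewrite /continuous_at {1}XE -[X in _ --> X]add0r; exact: cvgD.
have [t gt] : exists t, G (X t) 0 jm = q 0 jm.
  apply: (power_monotone_onto (g := fun t => G (X t) 0 jm) b1) => [t|s t].
    apply: (cvg_comp X (fun x => G x 0 jm) (cX t)).
    apply: (cvg_comp G (fun x : 'rV[R]_d => x 0 jm) (cG (X t))).
    exact: coord_continuous.
  have [->|st] := eqVneq s t.
    by rewrite subrr normr0 mul0r powR0// gt_eqF// (lt_trans _ b1).
  (* The index [i] must be m: below m the two values of [G] coincide, above m the two points do, and
     either would make the positive lower bound fail. *)
  have [i hi] := hG (X s) (X t).
  have st0 : 0 < `|s - t| by rewrite normr_gt0 subr_eq0.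
  have n_st : `|s - t| <= enorm (X s - X t).
    by apply: le_trans (coord_le_enorm _ jm); rewrite !mxE !Xm.
  have n_gt0 : 0 < enorm (X s - X t) := lt_le_trans st0 n_st.
  have [im|mi] := ltnP i m.
    have := lt_le_trans (powR_gt0 b n_gt0) hi.
    by rewrite ((hX s).2 i im) ((hX t).2 i im) subrr mulr0 ltxx.
  have ij : i = jm.
    apply: (Xlast s t) => //; apply: contraTneq hi => ->.
    by rewrite subrr mul0r -ltNge powR_gt0.
  move: hi; rewrite ij !Xm; apply: le_trans.
  by apply: ge0_ler_powR; rewrite ?nnegrE ?enorm_ge0// ltW// (lt_trans _ b1).
exists (X t); split=> [j|j].
  exact: Xa.
rewrite ltnS leq_eqVlt => /orP[/eqP jm'|]; last exact: (hX t).2.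
by have -> : j = jm by exact/val_inj.
Qed.

Lemma power_P_onto {R : realType} (d : nat) (G : 'rV[R]_d -> 'rV[R]_d) b :
  1 < b -> continuous G -> power_P_map b G -> forall q, exists x, G x = q.
Proof.
move=> b1 cG hG q; have [x [_ hx]] := power_P_partial_onto b1 cG hG (leqnn d) 0 q.
by exists x; apply/rowP => j; exact: hx.
Qed.

(** * Smoothing functions: tangent bound and range of [psi] *)

Section SmoothingFunction.
Context {R : realType} (theta : R -> R).
Hypothesis htheta : smoothing_function theta.

Lemma smoothing_concave l t : 0 <= l <= 1 -> l * theta t <= theta (l * t).
Proof.
move=> l01; case: htheta => _ cvx _ _ [_ t0 _].
pose i := Itv01 (andP l01).1 (andP l01).2.
have := cvx i t 0; rewrite !inE => /(_ Logic.I Logic.I).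
change (- theta (l * t + (1 - l) * 0) <= l * - theta t + (1 - l) * - theta 0 ->
  l * theta t <= theta (l * t)).
by rewrite t0 oppr0 !mulr0 !addr0 mulrN lerN2.
Qed.

(** Concavity gives [theta t <= theta (l * t) / l] for [0 < l <= 1]; the right-hand side tends to
    the derivative at 0 in direction [t] as [l] decreases to 0. *)
Lemma smoothing_tangent t : theta t <= derive1 theta 0 * t.
Proof.
case: (htheta) => -[dtheta _] _ _ _ [_ t0 _].
have [t_eq0|tN0] := eqVneq t 0; first by rewrite t_eq0 t0 mulr0.
have dt : derivable theta 0 t.
  exact/diff_derivable/derivable1_diffP.
have -> : derive1 theta 0 * t = 'D_t theta 0.
  rewrite derive1E !deriveE; try exact/derivable1_diffP.
  by rewrite -[in RHS](mulr1 t) [in RHS]linearZ/= mulrC.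
apply: cvgr_to_ge (cvg_dnbhs_at_right dt) _.
near=> l.
have l0 : 0 < l by near: l; exact: nbhs_right_gt.
have l1 : l <= 1 by near: l; exact: nbhs_right_le.
rewrite /= addr0 t0 subr0 -[_ *: _]/(_ * _) ler_pdivlMl//.
by rewrite smoothing_concave// (ltW l0).
Unshelve. all: by end_near. Qed.

(** This makes [pinv] a genuine right inverse at the arguments occurring in [G_]. *)
Lemma psi_onto v : 0 < v -> exists t, psi theta t = v.
Proof.
case: (htheta) => -[dtheta _] _ incr _ [neg t0 lim1] v0.
have ct : continuous theta.
  by move=> t; apply/differentiable_continuous/derivable1_diffP.
have [N N0 hN] : exists2 N, 0 <= N & psi theta N <= v.
  have /cvgrPdist_lt/(_ _ v0) := lim1.
  move=> [M [_ hM]]; exists (`|M| + 1); first by rewrite addr_ge0.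
  have := hM (`|M| + 1); rewrite (le_lt_trans (ler_norm _)) ?ltrDl// => /(_ isT).
  by rewrite /psi => /(le_lt_trans (ler_norm _))/ltW.
(* Concavity gives [theta (- T) <= T * theta (- 1)] once [1 <= T], which the final [+ 1] ensures;
   the quotient makes the right-hand side at most [- (v + 1)]. *)
pose T := (v + 1) / - theta (- 1) + 1.
have t1 : theta (- 1) < 0 by apply: neg; rewrite oppr_lt0.
have T1 : 1 <= T.
  by rewrite lerDr divr_ge0// ?oppr_ge0 ltW// addr_gt0.
have hT : v <= psi theta (- T).
  have T0 : 0 < T := lt_le_trans ltr01 T1.
  have : T^-1 * theta (- T) <= theta (T^-1 * - T).
    apply: smoothing_concave.
    by rewrite invr_ge0 (ltW T0) invf_le1.
  rewrite mulrN mulVf ?gt_eqF// ler_pdivrMl// /psi => h.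
  have : T * theta (- 1) <= - (v + 1).
    by rewrite /T mulrDl mul1r invrN mulrN mulNr divfK ?lt_eqF// gerDl ltW.
  by lra.
have [|||c _ hc] := @IVT _ (psi theta) (- T) N v; last by exists c.
- by rewrite (le_trans _ N0)// oppr_le0 (le_trans ler01).
- apply: continuous_subspaceT => t; apply: cvgB; [exact: cvg_cst|exact: ct].
- by rewrite ge_min hN orbT le_max hT.
Qed.

End SmoothingFunction.

(** * Elementary inequalities for complementarity errors *)

Section Complementarity.
Context {R : realType}.
Implicit Types s t u v tau e : R.

(** If [s] is the smaller number, both inverses are at most [(1 + s)^-1], so
    [tau <= 2 / (1 + s)]. *)
Lemma min_of_sum_inv_ge s t tau : 0 <= s -> 0 <= t -> 0 < tau ->
  tau <= (1 + s)^-1 + (1 + t)^-1 -> Num.min s t <= (2 - tau) / tau.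
Proof.
wlog st : s t / s <= t.
  move=> W s0 t0 tau0 h; have [st|/ltW ts] := leP s t.
    by rewrite -(min_l st); exact: W.
  by rewrite -(min_l ts); apply: W => //; rewrite addrC.
move=> s0 t0 tau0 h; rewrite (min_l st) ler_pdivlMr//.
have h1 : tau <= 2 / (1 + s).
  apply: (le_trans h); rewrite mulr_natl mulr2n lerD2l lef_pV2 ?posrE; lra.
move: h1; rewrite ler_pdivlMr; last lra.
by move=> h1; lra.
Qed.

(* With kappa = max tau (1 - e), clearing denominators in the bound on the sum
   gives kappa s t <= (2 - kappa) + (1 - kappa) (s + t). *)
Lemma mul_of_sum_inv_ge s t tau e : 0 <= s -> 0 <= t -> 0 < tau <= 1 ->
  0 <= e -> tau <= (1 + s)^-1 + (1 + t)^-1 ->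
  1 - e <= (1 + s)^-1 + (1 + t)^-1 ->
  s * t <= (2 - tau) / tau + e / tau * (s + t).
Proof.
move=> s0 t0 /andP[tau0 tau1] e0 htau he.
have E : (1 + s)^-1 + (1 + t)^-1 = (2 + s + t) / ((1 + s) * (1 + t)).
  by field; rewrite !gt_eqF//; lra.
have D0 : 0 < (1 + s) * (1 + t) by rewrite mulr_gt0//; lra.
move: htau he; rewrite E !ler_pdivlMr// => htau he.
rewrite -(ler_pM2l tau0).
have -> : tau * ((2 - tau) / tau + e / tau * (s + t)) =
    2 - tau + e * (s + t).
  by field; rewrite gt_eqF.
have st0 : 0 <= s * t by exact: mulr_ge0.
(* First case: [kappa = 1 - e] and [1 + e <= 2 - tau]. Second case: [kappa = tau] and
   [1 - tau < e]. *)
have [h|h] := leP tau (1 - e).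
  have : tau * (s * t) <= (1 - e) * (s * t) by exact: ler_wpM2r.
  by lra.
have : (1 - tau) * (s + t) <= e * (s + t) by apply: ler_wpM2r; lra.
by lra.
Qed.

(** Links the two kinds of error: if [F x = u + v] at [x = u - v], the residual of [F x = |x|] is
    twice the complementarity error. *)
Lemma add_sub_norm u v : u + v - `|u - v| = 2 * Num.min u v.
Proof.
by have [uv|/ltW vu] := leP u v; [rewrite ler0_norm|rewrite ger0_norm]; lra.
Qed.

Lemma dist_minr u v v' : `|Num.min u v - Num.min u v'| <= `|v - v'|.
Proof.
have [h1|h1] := leP u v; have [h2|h2] := leP u v'; rewrite ?subrr ?normr0//.
- rewrite !ger0_norm; lra.
- rewrite !ler0_norm; lra.
Qed.

(** Lowers an order in [r k] at the price of a constant; the bound [b] allows for early terms of the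
    sequence that exceed 1. *)
Lemma powR_le_lower_exp s b p q : 0 < s <= b -> q <= p ->
  s `^ p <= b `^ (p - q) * s `^ q.
Proof.
move=> /andP[s0 sb] qp; have -> : s `^ p = s `^ (p - q) * s `^ q.
  by rewrite -powRD ?subrK// (gt_eqF s0) implybT.
rewrite ler_wpM2r ?powR_ge0//.
by apply: ge0_ler_powR; rewrite ?nnegrE ?subr_ge0// ltW// (lt_le_trans s0).
Qed.

End Complementarity.

(** * From the constraint on [G_] to a lower bound on the sum of [psi] values *)

Section PsiSum.
Context {R : realType} (theta : R -> R).
Hypothesis htheta : smoothing_function theta.

Lemma psi_gt0 t : 0 < psi theta t.
Proof. by case: htheta => _ _ _ t1 _; rewrite subr_gt0. Qed.

Lemma psi_anti s t : s <= t -> psi theta t <= psi theta s.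
Proof.
case: htheta => _ _ incr _ _; rewrite le_eqVlt => /predU1P[->//|/incr/ltW h].
by rewrite /psi lerD2l lerN2.
Qed.

Lemma psi_ge_tangent t : 1 - `|derive1 (psi theta) 0| * `|t| <= psi theta t.
Proof.
case: (htheta) => -[dtheta _] _ _ _ _.
have -> : derive1 (psi theta) 0 = - derive1 theta 0.
  by rewrite !derive1E deriveB// derive_cst sub0r.
rewrite normrN -normrM lerD2l lerN2; apply: le_trans (ler_norm _).
exact: smoothing_tangent.
Qed.

(** Apply the decreasing [psi] to the bound on [G_]; the sum is positive, hence in the range of
    [psi], and [pinv] cancels. *)
Lemma psi_sum_ge d (r : R) (y z : 'rV[R]_d) i e : 0 < r ->
  G_ theta r y z 0 i <= e ->
  psi theta (e / r) <= psi theta (y 0 i / r) + psi theta (z 0 i / r).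
Proof.
move=> r0; rewrite mxE mulrC -ler_pdivlMr// => he; apply: le_trans (psi_anti he) _.
have v0 : 0 < psi theta (y 0 i / r) + psi theta (z 0 i / r).
  by rewrite addr_gt0// psi_gt0.
have [t <-] := psi_onto htheta v0.
by rewrite pinvK// inE; exists t.
Qed.

End PsiSum.

Lemma psi1_ge0E {R : realType} (t : R) : 0 <= t -> psi1 t = (1 + t)^-1.
Proof.
move=> t0; rewrite /psi1 /psi /theta1 t0.
by field; rewrite !gt_eqF//=; lra.
Qed.

(** Surjectivity of [F + I] gives [F u + u = 2 y] for the point [u = y - H y] chosen by [pinv]. *)
Lemma F_sub_H {R : realType} (d : nat) (F : 'rV[R]_d -> 'rV[R]_d) b y :
  1 < b -> continuous F -> power_P_map b (fun x => F x + x) ->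
  F (y - H_ F y) = y + H_ F y.
Proof.
move=> b1 cF hF; rewrite /H_; set u := pinv _ _ _.
have uE : F u + u = 2 *: y.
  have cFI : continuous (fun x => F x + x).
    by move=> x; exact: (cvgD (cF x) cvg_id).
  have yI : 2 *: y \in range (fun x => F x + x).
    by rewrite inE; have [x hx] := power_P_onto b1 cFI hF (2 *: y); exists x.
  exact: pinvK yI.
have -> : y - (y - u) = u by rewrite opprB addrC subrK.
by apply: (addIr u); rewrite uE -addrA subrK scaler_nat mulr2n.
Qed.

Lemma cvg_gt0_bounded {R : realType} (r : nat -> R) :
  (forall k, 0 < r k) -> r k @[k --> \oo] --> (0 : R) ->
  exists2 B, 0 < B & forall k, 0 < r k <= B.
Proof.
move=> r0 rcvg; have /cvg_seq_bounded : cvgn r by apply/cvg_ex; exists 0.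
move=> [M [_ hM]]; exists (`|M| + 1) => [|k]; first by rewrite ltr_wpDl.
rewrite r0/=; apply: le_trans (ler_norm _) _.
by apply: hM => //; rewrite (le_lt_trans (ler_norm M))// ltrDl.
Qed.

(** * The error estimates along the sequences *)

Section Proposition.
Context {R : realType} {d : nat}.
Variables (F : 'rV[R]_d -> 'rV[R]_d) (theta : R -> R).
Variables (r : nat -> R) (y z : nat -> 'rV[R]_d) (eps1 eps2 : nat -> R).
Variables (gamma sigma : R).
Hypotheses (hF : assumption_a F) (htheta : assumption_b theta).
Hypothesis hseq : assumption_c F theta r y z eps1 eps2 gamma sigma.

(** As [sigma >= 1] and [r] is bounded, the ratios [eps2 k / r k] stay below some [M], and
    [psi theta M] bounds the sums from below. *)
Lemma tau_bound_exists : exists tau, tau_bound theta r y z tau.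
Proof.
case: htheta => sm _ _.
case: hseq => -[r0 rcvg] yz0 [_ hG] [_ [C2 hC2]] [_ sigma1].
have [B B0 rB] := cvg_gt0_bounded r0 rcvg.
pose M := `|C2| * B `^ (sigma - 1); exists (Num.min 1 (psi theta M)).
split; first by rewrite lt_min ltr01 psi_gt0// ge_min lexx.
move=> i k; apply: le_trans (psi_sum_ge sm (r0 k) (hG k i)).
rewrite ge_min; apply/orP; right; apply: psi_anti => //.
rewrite ler_pdivrMr// /M -mulrA; apply: le_trans (ler_norm _) _.
apply: le_trans (hC2 k) _.
apply: (@le_trans _ _ (`|C2| * r k `^ sigma)).
  by rewrite ler_wpM2r ?powR_ge0// ler_norm.
rewrite ler_wpM2l//.
by rewrite -[X in _ * X](powRr1 (ltW (r0 k))) powR_le_lower_exp.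
Qed.

Variable tau : R.
Hypothesis htau : tau_bound theta r y z tau.

Let tau0 : 0 < tau. Proof. by case: htau => /andP[]. Qed.

Lemma sum_inv_ge (i : 'I_d) k v :
  v <= psi theta (y k 0 i / r k) + psi theta (z k 0 i / r k) ->
  v <= (1 + y k 0 i / r k)^-1 + (1 + z k 0 i / r k)^-1.
Proof.
move=> h; case: htheta => _ psile _; case: hseq => -[r0 _] yz0 _ _ _.
have [y0 z0] := yz0 k i.
have rk0 := ltW (r0 k); apply: (le_trans h).
by rewrite -!psi1_ge0E ?divr_ge0//; apply: lerD.
Qed.

Lemma min_yz_le (i : 'I_d) k :
  Num.min (y k 0 i) (z k 0 i) <= (2 - tau) / tau * r k.
Proof.
case: hseq => -[r0 _] yz0 _ _ _; have [y0 z0] := yz0 k i.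
have rk0 := ltW (r0 k).
have := min_of_sum_inv_ge (divr_ge0 y0 rk0) (divr_ge0 z0 rk0) tau0
  (sum_inv_ge (htau.2 i k)).
by rewrite -minr_pMl ?invr_ge0// ler_pdivrMr.
Qed.

Lemma mul_yz_le : exists2 C, 0 <= C & forall (i : 'I_d) k,
  y k 0 i * z k 0 i <= (2 - tau) / tau * r k ^+ 2
    + C * `|derive1 (psi theta) 0| / tau * (y k 0 i + z k 0 i) * r k `^ sigma.
Proof.
case: htheta => sm _ _.
case: hseq => -[r0 _] yz0 [_ hG] [_ [C2 hC2]] _.
exists `|C2| => // i k; have [y0 z0] := yz0 k i; have rk0 := ltW (r0 k).
(* The tangent bound at [eps2 k / r k] keeps the sum above [1 - e]; multiplying the scaled
   inequality by [r k ^+ 2] turns the [e] term into the one of order [sigma]. *)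
set D := `|derive1 _ _|; pose e := D * (`|C2| * r k `^ sigma) / r k.
have e0 : 0 <= e by rewrite divr_ge0// !mulr_ge0 ?powR_ge0 ?normr_ge0.
have he : 1 - e <= (1 + y k 0 i / r k)^-1 + (1 + z k 0 i / r k)^-1.
  apply: sum_inv_ge; apply: le_trans (psi_sum_ge sm (r0 k) (hG k i)).
  apply: le_trans (psi_ge_tangent sm _); rewrite lerD2l lerN2 -/D /e -mulrA.
  rewrite ler_wpM2l ?normr_ge0// normrM normfV (ger0_norm rk0) ler_wpM2r ?invr_ge0//.
  by apply: le_trans (hC2 k) _; rewrite ler_wpM2r ?powR_ge0// ler_norm.
have := mul_of_sum_inv_ge (divr_ge0 y0 rk0) (divr_ge0 z0 rk0) htau.1 e0
  (sum_inv_ge (htau.2 i k)) he.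
rewrite -(ler_pM2r (exprn_gt0 2 (r0 k))); congr (is_true (_ <= _)).
  by field; rewrite gt_eqF.
by rewrite /e; field; rewrite !gt_eqF.
Qed.

Let w k := z k - F (y k - z k) + y k.

(** The order [gamma] serves the approximation of [H], the linear bound serves the equation error;
    the factor [1 + B ^ (gamma - 1)] covers both. *)
Lemma w_le : exists2 C, 0 <= C &
  forall k, enorm (w k) <= C * r k `^ gamma /\ enorm (w k) <= C * r k.
Proof.
case: hseq => -[r0 rcvg] _ [hw _] [[C1 hC1] _] [gamma1 _].
have [B B0 rB] := cvg_gt0_bounded r0 rcvg.
pose C := `|C1| * (1 + B `^ (gamma - 1)).
have B1 : 0 <= B `^ (gamma - 1) by exact: powR_ge0.
exists C => [|k]; first by rewrite mulr_ge0// addr_ge0.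
have h : enorm (w k) <= `|C1| * r k `^ gamma.
  apply: le_trans (hw k) _; apply: le_trans (ler_norm _) _.
  by apply: le_trans (hC1 k) _; rewrite ler_wpM2r ?powR_ge0// ler_norm.
split; apply: (le_trans h); rewrite -mulrA ler_wpM2l//.
  by rewrite ler_peMl ?powR_ge0// lerDl.
apply: le_trans (powR_le_lower_exp (rB k) gamma1) _.
by rewrite powRr1 ?(ltW (r0 k))// ler_wpM2r ?(ltW (r0 k))// lerDr.
Qed.

Let FE k : F (y k - z k) = z k + y k - w k.
Proof. by rewrite /w (addrAC (z k) (- F _)) subKr. Qed.

Let FEi k i : F (y k - z k) 0 i = z k 0 i + y k 0 i - w k 0 i.
Proof. by rewrite FE; move: (w k) => v; rewrite !mxE. Qed.

Lemma F_abs_le : exists2 C, 0 <= C & forall (i : 'I_d) k,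
  `|F (y k - z k) 0 i - `|(y k - z k) 0 i| | <= (C + (4 - 2 * tau) / tau) * r k.
Proof.
case: hseq => -[r0 rcvg] yz0 _ _ _.
have [C C0 hC] := w_le; exists C => // i k; have [y0 z0] := yz0 k i.
have -> : (y k - z k) 0 i = y k 0 i - z k 0 i by rewrite !mxE.
rewrite FEi.
have -> : z k 0 i + y k 0 i - w k 0 i - `|y k 0 i - z k 0 i| =
    2 * Num.min (y k 0 i) (z k 0 i) - w k 0 i.
  by rewrite -add_sub_norm; ring.
apply: le_trans (ler_normB _ _) _; rewrite addrC [leRHS]mulrDl; apply: lerD.
  by apply: le_trans (coord_le_enorm _ i) _; exact: (hC k).2.
rewrite ger0_norm ?mulr_ge0 ?le_min ?y0//.
apply: le_trans (ler_wpM2l _ (min_yz_le i k)) _ => //.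
by rewrite le_eqVlt; apply/orP; left; apply/eqP; field; rewrite gt_eqF.
Qed.

Variables (h : R -> R) (beta : R).
Hypotheses (d0 : (0 < d)%N) (cF : continuous F).
Hypothesis hP : uniform_P_map h (fun x => F x - x).
Hypotheses (beta1 : 1 < beta) (hbeta : forall t, 0 <= t -> t `^ beta <= h t).

Let hP1 : power_P_map beta (fun x => F x - x).
Proof. exact: uniform_P_power_P hP hbeta. Qed.

Let hP2 : power_P_map beta (fun x => F x + x).
Proof. exact: power_P_map_addx. Qed.

Let FH k : F (y k - H_ F (y k)) = y k + H_ F (y k).
Proof. exact: F_sub_H beta1 cF hP2. Qed.

(** [F + I] takes the values [2 y - w] and [2 y] at [y - z] and [y - H y], so the error bound
    applies with the size of [w]. *)
Lemma H_approx : exists2 C, 0 <= C & forall k,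
  enorm (z k - H_ F (y k)) <= C * r k `^ (gamma / (beta - 1)).
Proof.
have [C C0 hC] := w_le; exists (C `^ (beta - 1)^-1) => [|k].
  exact: powR_ge0.
rewrite powRrM -powRM ?powR_ge0//.
have -> : z k - H_ F (y k) = (y k - H_ F (y k)) - (y k - z k).
  by move: (H_ F (y k)) => v; rewrite opprB [RHS]addrC [RHS]addrA subrK.
apply: (power_P_map_error beta1 hP2) => [|i].
  by rewrite mulr_ge0 ?powR_ge0.
apply: le_trans (ler_norm _) _; rewrite normrM ler_wpM2l//.
rewrite FH FE; apply: le_trans (hC k).1; apply: le_trans (coord_le_enorm _ i).
move: (w k) => v; rewrite le_eqVlt; apply/orP; left; apply/eqP.
by congr `|_|; rewrite !mxE; ring.
Qed.

Lemma yz_bounded : exists2 M, 0 <= M &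
  forall (i : 'I_d) k, y k 0 i <= M /\ z k 0 i <= M.
Proof.
case: hF => -[x0 [x0E _]] _; case: hseq => -[r0 rcvg] yz0 _ _ _.
have [B B0 rB] := cvg_gt0_bounded r0 rcvg.
have [C C0 hC] := F_abs_le; pose e := (C + (4 - 2 * tau) / tau) * B.
have Ct0 : 0 <= C + (4 - 2 * tau) / tau.
  have /andP[_ t1] := htau.1; rewrite addr_ge0// divr_ge0 ?ltW//; lra.
have e0 : 0 <= e by rewrite mulr_ge0// ltW.
have hx k : enorm ((y k - z k) - x0) <= e `^ (beta - 1)^-1.
  apply: (power_P_map_error beta1 hP1) => // i.
  pose a := (y k - z k) 0 i; pose c := x0 0 i.
  pose f := F (y k - z k) 0 i - `|a|.
  have fe : `|f| <= e.
    by apply: le_trans (hC i k) _; rewrite ler_wpM2l// (andP (rB k)).2.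
  have Fx0 : F x0 0 i = `|c| by rewrite x0E mxE.
  have -> : (F (y k - z k) - (y k - z k)) 0 i - (F x0 - x0) 0 i =
      ((`|a| - a) - (`|c| - c)) + f.
    by rewrite /f /a [LHS]/= !mxE -Fx0 /c; ring.
  rewrite -/a -/c mulrDr.
  (* With this sign, only the residual [f] enters the error bound. *)
  have anti : (a - c) * ((`|a| - a) - (`|c| - c)) <= 0.
    have -> : (a - c) * ((`|a| - a) - (`|c| - c)) =
      (a - c) * (`|a| - `|c|) - `|a - c| * `|a - c|.
      by rewrite -expr2 real_normK ?num_real//; ring.
    rewrite subr_le0; apply: le_trans (ler_norm _) _.
    by rewrite normrM ler_wpM2l// ler_dist_dist.
  apply: (@le_trans _ _ ((a - c) * f)); first by rewrite gerDr.
  by apply: le_trans (ler_norm _) _; rewrite normrM ler_wpM2l.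
(* [N] bounds [|y - z|]; added to the bound on the minimum of [y] and [z], it bounds their
   maximum. *)
pose N := e `^ (beta - 1)^-1 + enorm x0.
have N0 : 0 <= N by rewrite addr_ge0 ?powR_ge0 ?enorm_ge0.
have t2 : 0 <= (2 - tau) / tau.
  have /andP[_ t1] := htau.1; rewrite divr_ge0 ?ltW//; lra.
exists ((2 - tau) / tau * B + N) => [|i k].
  by rewrite addr_ge0// mulr_ge0// ltW.
have hN : `|y k 0 i - z k 0 i| <= N.
  have -> : y k 0 i - z k 0 i = ((y k - z k) - x0) 0 i + x0 0 i.
    by rewrite !mxE; ring.
  apply: le_trans (ler_normD _ _) _; apply: lerD; last exact: coord_le_enorm.
  by apply: le_trans (hx k); exact: coord_le_enorm.
have hm : Num.min (y k 0 i) (z k 0 i) <= (2 - tau) / tau * B.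
  by apply: le_trans (min_yz_le i k) _; rewrite ler_wpM2l// (andP (rB k)).2.
have := add_sub_norm (y k 0 i) (z k 0 i).
have := ler_norm (y k 0 i - z k 0 i).
have := ler_norm (- (y k 0 i - z k 0 i)); rewrite normrN.
by move=> *; split; lra.
Qed.

Lemma H_dist_le : beta - 1 < gamma -> exists2 C, 0 <= C &
  forall (i : 'I_d) k, `|z k 0 i - H_ F (y k) 0 i| <= C * r k.
Proof.
move=> bg; case: hseq => -[r0 rcvg] _ _ _ _.
have [B B0 rB] := cvg_gt0_bounded r0 rcvg.
have p1 : 1 <= gamma / (beta - 1).
  by rewrite ler_pdivlMr ?subr_gt0// mul1r ltW.
have [C C0 hC] := H_approx.
exists (C * B `^ (gamma / (beta - 1) - 1)) => [|i k].
  by rewrite mulr_ge0// powR_ge0.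
have -> : z k 0 i - H_ F (y k) 0 i = (z k - H_ F (y k)) 0 i by rewrite !mxE.
apply: le_trans (coord_le_enorm _ i) _; apply: le_trans (hC k) _.
rewrite -mulrA ler_wpM2l//.
apply: le_trans (powR_le_lower_exp (rB k) p1) _.
by rewrite powRr1// (ltW (r0 k)).
Qed.

(** The minimum is 1-Lipschitz in its second argument. The bound is two-sided because coordinates of
    [H (y k)] may be negative and [F_abs_H_le] needs the absolute value. *)
Lemma min_yH_le : beta - 1 < gamma -> exists C, forall (i : 'I_d) k,
  `|Num.min (y k 0 i) (H_ F (y k) 0 i)| <= C * r k.
Proof.
move=> bg; have [C C0 hC] := H_dist_le bg.
exists (C + (2 - tau) / tau) => i k; case: hseq => _ yz0 _ _ _.
have [y0 z0] := yz0 k i.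
have := le_trans (dist_minr (y k 0 i) (z k 0 i) (H_ F (y k) 0 i)) (hC i k).
have := min_yz_le i k.
have : 0 <= Num.min (y k 0 i) (z k 0 i) by rewrite le_min y0.
rewrite !ler_norml mulrDl => m0 mt /andP[m1 m2].
by apply/andP; split; lra.
Qed.

(** Write [y H = y z + y (H - z)] with [y], [z] bounded: the terms have orders 2, [sigma] and
    [gamma / (beta - 1)], each lowered to the minimum. *)
Lemma mul_yH_le : exists C, forall (i : 'I_d) k, y k 0 i * H_ F (y k) 0 i <=
  C * r k `^ Num.min 2 (Num.min sigma (gamma / (beta - 1))).
Proof.
case: hseq => -[r0 rcvg] yz0 _ _ _.
have [B B0 rB] := cvg_gt0_bounded r0 rcvg.
have [M M0 hM] := yz_bounded.
have [C1 C10 hC1] := mul_yz_le; have [C2 C20 hC2] := H_approx.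
set p := gamma / (beta - 1); set q := Num.min 2 _.
pose D := C1 * `|derive1 (psi theta) 0| / tau.
have D0 : 0 <= D by rewrite divr_ge0 ?mulr_ge0// ltW.
have t2 : 0 <= (2 - tau) / tau.
  have /andP[_ t1] := htau.1; rewrite divr_ge0 ?ltW//; lra.
exists ((2 - tau) / tau * B `^ (2 - q) + D * (2 * M) * B `^ (sigma - q)
        + M * C2 * B `^ (p - q)) => i k.
have [y0 z0] := yz0 k i; have [yM zM] := hM i k.
have -> : y k 0 i * H_ F (y k) 0 i =
    y k 0 i * z k 0 i + y k 0 i * (H_ F (y k) 0 i - z k 0 i) by ring.
rewrite [leRHS]mulrDl; apply: lerD.
  rewrite [leRHS]mulrDl; apply: le_trans (hC1 i k) _; apply: lerD.
    rewrite -[leRHS]mulrA ler_wpM2l// -(powR_mulrn 2 (ltW (r0 k))).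
    by apply: powR_le_lower_exp => //; rewrite ge_min lexx.
  rewrite -/D -[leRHS]mulrA; apply: ler_pM.
  - by rewrite mulr_ge0// addr_ge0.
  - exact: powR_ge0.
  - by rewrite ler_wpM2l//; lra.
  - by apply: powR_le_lower_exp => //; rewrite !ge_min lexx orbT.
rewrite -!mulrA; apply: le_trans (ler_norm _) _.
rewrite normrM (ger0_norm y0); apply: ler_pM => //.
have -> : H_ F (y k) 0 i - z k 0 i = - (z k - H_ F (y k)) 0 i.
  by rewrite !mxE opprB.
rewrite normrN; apply: le_trans (coord_le_enorm _ i) _.
apply: le_trans (hC2 k) _; rewrite ler_wpM2l//.
by apply: powR_le_lower_exp => //; rewrite !ge_min lexx !orbT.
Qed.

(** Since [F (y - H y) = y + H y] exactly, the residual is [2 * min (y, H y)] in each coordinate. *)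
Lemma F_abs_H_le : beta - 1 < gamma -> exists C, forall (i : 'I_d) k,
  `|F (y k - H_ F (y k)) 0 i - `|(y k - H_ F (y k)) 0 i| | <= C * r k.
Proof.
move=> bg; have [C hC] := min_yH_le bg; exists (2 * C) => i k.
have := hC i k; rewrite FH; move: (H_ F (y k)) => v hv.
by rewrite !mxE add_sub_norm normrM ger0_norm// -mulrA ler_wpM2l.
Qed.

End Proposition.

Theorem proposition3p6 (R : realType) (d : nat) (F : 'rV[R]_d -> 'rV[R]_d)
    (theta : R -> R) (r : nat -> R) (y z : nat -> 'rV[R]_d)
    (eps1 eps2 : nat -> R) (gamma sigma : R)
    (hd : (0 < d)%N)
    (hF : assumption_a F)
    (htheta : assumption_b theta)
    (hseq : assumption_c F theta r y z eps1 eps2 gamma sigma) :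
  (exists tau, tau_bound theta r y z tau) /\
  forall tau, tau_bound theta r y z tau ->
  [/\ (* (i) *)
      exists2 C, 0 <= C & forall (i : 'I_d) (k : nat),
        Num.min (y k 0 i) (z k 0 i) <= (2 - tau) / tau * r k /\
        0 <= y k 0 i * z k 0 i <=
          (2 - tau) / tau * r k ^+ 2
          + C * `|derive1 (psi theta) 0| / tau * (y k 0 i + z k 0 i) * r k `^ sigma,
      (* (ii) *)
      exists2 C, 0 <= C & forall (i : 'I_d) (k : nat),
        `|F (y k - z k) 0 i - `|(y k - z k) 0 i| |
          <= (C + (4 - 2 * tau) / tau) * r k &
      forall (h : R -> R) (beta : R),
        continuous F ->
        uniform_P_map h (fun x => F x - x) ->
        1 < beta ->
        (forall t, 0 <= t -> t `^ beta <= h t) ->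
        [/\ (* (iii) *)
            exists C, forall k : nat,
              enorm (z k - H_ F (y k)) <= C * r k `^ (gamma / (beta - 1)),
            (* (iv) *)
            (exists M, forall k : nat, enorm (y k) <= M) /\
            (exists M, forall k : nat, enorm (z k) <= M),
            (* (v) *)
            beta - 1 < gamma ->
              (exists C, forall (i : 'I_d) (k : nat),
                 Num.min (y k 0 i) (H_ F (y k) 0 i) <= C * r k) /\
              (exists C, forall (i : 'I_d) (k : nat),
                 y k 0 i * H_ F (y k) 0 i <=
                   C * r k `^ Num.min 2 (Num.min sigma (gamma / (beta - 1)))) &
            (* (vi) *)
            beta - 1 < gamma ->
              exists C, forall (i : 'I_d) (k : nat),
                `|F (y k - H_ F (y k)) 0 i - `|(y k - H_ F (y k)) 0 i| |
                  <= C * r k]].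
Proof.
split; first exact: (tau_bound_exists htheta hseq).
move=> tau htau; split.
- have [C C0 hC] := mul_yz_le htheta hseq htau; exists C => // i k; split.
    exact: (min_yz_le htheta hseq htau).
  case: hseq => _ yz0 _ _ _; have [y0 z0] := yz0 k i.
  by rewrite mulr_ge0//= hC.
- exact: (F_abs_le htheta hseq htau).
- move=> h beta cF hP beta1 hbeta; split.
  + by have [C _ hC] := H_approx hseq hd cF hP beta1 hbeta; exists C.
  + have [M M0 hM] := yz_bounded hF htheta hseq htau hd hP beta1 hbeta.
    case: hseq => _ yz0 _ _ _.
    by split; exists (Num.sqrt d%:R * M) => k; apply: enorm_le_coord => // i;
      have [[y0 z0] [yM zM]] := (yz0 k i, hM i k); rewrite ger0_norm.
  + move=> bg; split; last first.
      exact: (mul_yH_le hF htheta hseq htau hd cF hP beta1 hbeta).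
    have [C hC] := min_yH_le htheta hseq htau hd cF hP beta1 hbeta bg.
    by exists C => i k; apply: le_trans (hC i k); exact: ler_norm.
  + exact: (F_abs_H_le htheta hseq htau hd cF hP beta1 hbeta).
Qed.
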